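(* Let $\alpha\in[0,1)$. If $(X,f)$ is an $M$-system with the $\mathscr{M}_{\alpha}$-shadowing property, then $(X,f)$ is weakly mixing.
   Context: $\mathbb{N}=\{1,2,3,\ldots\}$ and $\mathbb{N}_0=\{0,1,2,\ldots\}$. A dynamical system is a pair $(X,f)$ where $(X,d)$ is a compact metric space and $f\colon X\to X$ is a continuous surjection. Transitivity notions: for $A,B\subseteq X$, $N_f(A,B)=\{n\in\mathbb{N}: f^n(A)\cap B\neq\varnothing\}$. $(X,f)$ is transitive if $N_f(U,V)\neq\varnothing$ for all nonempty open $U,V\subseteq X$; it is weakly mixing if $(X\times X,f\times f)$ is transitive. The orbit of $x$ is $\{f^n(x):n\in\mathbb{N}_0\}$; a system is minimal if every point has dense orbit. A point $x$ is a minimal point if the restriction of $f$ to the closure of the orbit of $x$ is a minimal system. $(X,f)$ is an $M$-system if it is transitive and its set of minimal points is dense in $X$. Density and shadowing: for $A\subseteq\mathbb{N}_0$, $\underline{\mathrm{Dens}}(A)=\liminf_{n\to\infty}\frac{\#(A\cap\{0,\ldots,n\})}{n+1}$. For $\alpha\in[0,1)$, $\mathscr{M}_\alpha$ is the family of all $A\subseteq\mathbb{N}_0$ with $\underline{\mathrm{Dens}}(A)>\alpha$. For $\delta>0$, a sequence $\{x_i\}_{i=0}^\infty\subseteq X$ is a $\delta$-ergodic pseudo-orbit if $\lim_{n\to\infty}\frac{1}{n}\#\{0\le i<n: d(f(x_i),x_{i+1})\ge\delta\}=0$. $(X,f)$ has the $\mathscr{M}_\alpha$-shadowing property if for every $\varepsilon>0$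 there is $\delta>0$ such that for every $\delta$-ergodic pseudo-orbit $\{x_i\}_{i=0}^\infty$ there is $z\in X$ with $\{j\in\mathbb{N}_0: d(f^j(z),x_j)<\varepsilon\}\in\mathscr{M}_\alpha$. *)

(* Defs.v *)
From HB Require Import structures.
From mathcomp Require Import all_boot all_order all_algebra.
From mathcomp Require Import all_classical all_reals all_analysis.

Set Implicit Arguments.
Unset Strict Implicit.
Unset Printing Implicit Defensive.

Import Order.TTheory GRing.Theory Num.Theory.
Import numFieldNormedType.Exports.

Local Open Scope classical_set_scope.
Local Open Scope ring_scope.

Definition dynamical_system (R : realType) (X : metricType R) (f : X -> X) :
    Prop :=
  [/\ compact [set: X], continuous f & set_surj [set: X] [set: X] f].

Definition hitting_times (X : Type) (f : X -> X) (A B : set X) : set nat :=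
  [set n | (0 < n)%N /\ (iter n f @` A) `&` B !=set0].

Definition topologically_transitive (X : topologicalType) (f : X -> X) :
    Prop :=
  forall U V : set X, open U -> open V -> U !=set0 -> V !=set0 ->
    hitting_times f U V !=set0.

Definition weakly_mixing (X : topologicalType) (f : X -> X) : Prop :=
  topologically_transitive (fun p : X * X => (f p.1, f p.2)).

Definition orbit_set (X : Type) (f : X -> X) (x : X) : set X :=
  range (fun n => iter n f x).

(* The restriction of the continuous map f to K is a minimal system: f maps K
   onto K, and orbits of points of K are dense in K for the subspace
   topology. *)
Definition minimal_on (X : topologicalType) (f : X -> X) (K : set X) : Prop :=
  f @` K = K /\ forall y, K y -> K `<=` closure (orbit_set f y).

Definition minimal_point (X : topologicalType) (f : X -> X) (x : X) : Prop :=
  minimal_on f (closure (orbit_set f x)).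

Definition M_system (X : topologicalType) (f : X -> X) : Prop :=
  topologically_transitive f /\ dense [set x | minimal_point f x].

Definition count_below (A : set nat) (n : nat) : nat :=
  #|[pred i : 'I_n | (i : nat) \in A]|.

Definition lower_density (R : realType) (A : set nat) : R :=
  limn_inf (fun n : nat => (count_below A n.+1)%:R / n.+1%:R : R).

Definition density_family (R : realType) (alpha : R) : set (set nat) :=
  [set A | alpha < lower_density R A].

Definition ergodic_pseudo_orbit (R : realType) (X : metricType R) (f : X -> X)
    (delta : R) (x : nat -> X) : Prop :=
  (fun n : nat =>
    (count_below [set i | delta <= mdist (f (x i)) (x i.+1)] n)%:R / n%:R : R)
    @ \oo --> (0 : R).

Definition density_shadowing (R : realType) (X : metricType R) (f : X -> X)
    (alpha : R) : Prop :=
  forall eps : R, 0 < eps -> exists2 delta : R, 0 < delta &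
    forall x : nat -> X, ergodic_pseudo_orbit f delta x ->
      exists z : X,
        density_family alpha [set j | mdist (iter j f z) (x j) < eps].

(* Main.v *)
Require Import Defs.
From mathcomp Require Import all_boot all_order all_algebra.
From mathcomp Require Import all_classical all_reals all_analysis.
From mathcomp Require Import zify lra.

(** Write N(U, V) for the set of times n > 0 with f^n(U) meeting V.

  The heart of the proof is that every open W containing a minimal point u,
  and every r, admit a time t > 0 with t in N(W, W) and t + r in N(W, W).
  Let a pseudo-orbit follow f^j(u) on some blocks of times j and f^(j+r)(u) on
  the others, the two kinds of blocks alternating.  The lengths of the blocks
  grow so fast that, on the one hand, the changes of phase have density zero,
  so that this is an ergodic pseudo-orbit, and on the other hand a set of
  positive lower density meets every block from some point on.  Hence a point
  z given by shadowing is close to f^j(u) for some j in a block of the first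
  kind, and close to f^(j'+r)(u) for some j' in a later block of the second
  kind.  By minimality and compactness, the closeness can be chosen such that
  two points that close, one of them in the orbit of u, enter W
  simultaneously: for some e and e', the points f^(j+e)(z), f^(j+e)(u),
  f^(j'+e')(z) and f^(j'+e'+r)(u) all lie in W.  Then t = j' + e' - (j + e)
  belongs to N(W, W) because of z, and t + r because of u
  ([shifted_return_times]).

  When W is chosen, using transitivity and the density of minimal points, so
  that it lies in A, f^p(W) in B and f^(r+p)(W) in D, the time t + r lies in
  both N(A, A) and N(B, D).  A classical rearrangement of return times, in the
  spirit of Furstenberg and Petersen, turns this into weak mixing
  ([M_system_weakly_mixing]). *)

Set Implicit Arguments.
Unset Strict Implicit.
Unset Printing Implicit Defensive.

Import Order.TTheory GRing.Theory Num.Theory.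
Import numFieldNormedType.Exports.

Local Open Scope classical_set_scope.
Local Open Scope ring_scope.

(** * Counting and lower density *)

Lemma count_belowS (A : set nat) (n : nat) :
  count_below A n.+1 = (count_below A n + (n \in A))%N.
Proof.
rewrite /count_below -!sum1_card big_mkcond [in RHS]big_mkcond /=.
rewrite big_ord_recr /=; congr (_ + _)%N.
Qed.

Lemma count_below0 (A : set nat) : count_below A 0 = 0%N.
Proof. by apply: eq_card0 => -[]. Qed.

Lemma count_below_le (A : set nat) (n : nat) : (count_below A n <= n)%N.
Proof. by rewrite -[leqRHS](card_ord n) max_card. Qed.

Lemma count_below_gap (A : set nat) (m n : nat) :
  (forall i, (m <= i < n)%N -> ~ A i) -> (count_below A n <= m)%N.
Proof.
elim: n => [|n IHn] gapA; first by rewrite count_below0.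
have [n_lt_m|m_le_n] := ltnP n m; first exact: leq_trans (count_below_le _ _) _.
rewrite count_belowS memNset ?addn0; last by apply: gapA; rewrite m_le_n ltnSn.
by apply: IHn => i /andP[mi ni]; apply: gapA; rewrite mi ltnW.
Qed.

(** Each jump of a nondecreasing L raises it by at least one, so there have
    been at most L n of them before n. *)
Lemma count_below_jumps (L : nat -> nat) (A : set nat) (n : nat) :
  {homo L : i j / (i <= j)%N} -> (forall i, A i -> L i != L i.+1) ->
  (count_below A n <= L n)%N.
Proof.
move=> L_homo jumpA; elim: n => [|n IHn]; first by rewrite count_below0.
rewrite count_belowS; have := L_homo _ _ (leqnSn n).
have [/set_mem/jumpA|_] := boolP (n \in A); lia.
Qed.

(** The frequencies lie in [0, 1], so their lower limit is a genuine limit of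
    infima; if it is positive, one of these infima is already positive, and it
    serves as the constant c. *)
Lemma lower_density_gt0 (R : realType) (A : set nat) :
  0 < lower_density R A ->
  exists2 c : R, 0 < c & exists N : nat, forall n, (N < n)%N ->
    c * n%:R <= (count_below A n)%:R.
Proof.
rewrite /lower_density; set u := fun n : nat => _ => dens_gt0.
have u_ge0 n : 0 <= u n by rewrite divr_ge0.
have u_le1 n : u n <= 1.
  by rewrite ler_pdivrMr ?ltr0n // mul1r ler_nat count_below_le.
have lbu : has_lbound (range u) by exists 0 => _ [n _ <-].
have ubu : has_ubound (range u) by exists 1 => _ [n _ <-].
have [N infN] : exists N, 0 < infs u N.
  apply/not_existsP => infs_le0; move: dens_gt0; apply/negP; rewrite -leNgt.
  apply: limr_le; last by apply: nearW => n; rewrite leNgt; apply/negP.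
  by apply/cvg_ex; eexists; exact: cvg_infs_sup.
exists (infs u N) => //; exists N => -[//|n] Nn.
rewrite -ler_pdivlMr ?ltr0n //; apply: ge_inf; last by exists n.
exact: has_lbound_sdrop.
Qed.

(** * Doubly exponential blocks of times *)

(** The blocks are the fibres of [level], namely [2^2^n, 2^2^(n+1)) for n > 0.
    The right end of a block is the square of its left end, so a block is
    overwhelmingly longer than everything before it. *)
Definition level (j : nat) : nat := trunc_log 2 (trunc_log 2 j).

Lemma level_homo : {homo level : i j / (i <= j)%N}.
Proof. by move=> i j ij; do 2!apply: leq_trunc_log. Qed.

Lemma level_eq (n i : nat) :
  (2 ^ 2 ^ n <= i < 2 ^ 2 ^ n.+1)%N -> level i = n.
Proof.
move=> /andP[le_i lt_i].
have i_gt0 : (0 < i)%N by rewrite (leq_trans _ le_i) ?expn_gt0.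
apply: trunc_log_eq => //; apply/andP; split; first exact: trunc_log_max.
rewrite -(ltn_exp2l _ _ (ltnSn 1)); apply: leq_ltn_trans lt_i.
exact: trunc_logP.
Qed.

(** Makes the number of block changes before n at most the square root of n,
    hence negligible with respect to n. *)
Lemma level_sqr (j : nat) : (level j * level j <= j)%N.
Proof.
have [->|j_gt0] := posnP j; first by rewrite /level; vm_compute.
rewrite /level; have := trunc_logP (ltnSn 1) j_gt0; set k := trunc_log 2 j.
have [->|k_gt0] := posnP k; first by have -> : trunc_log 2 0 = 0%N by [].
have := trunc_logP (ltnSn 1) k_gt0; case: (trunc_log 2 k) => // l lk kj.
apply: leq_trans kj; apply: leq_trans (leq_pexp2l _ lk) => //.
have ll : (l.+1 <= 2 ^ l.+1)%N by apply: ltnW; exact: ltn_expl.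
apply: leq_trans (leq_mul ll ll) _; rewrite -expnD leq_pexp2l //.
rewrite expnS addnn -mul2n leq_mul2l; exact: ltn_expl.
Qed.

Lemma level_le (j : nat) : (level j <= j)%N.
Proof.
apply: leq_trans (level_sqr j).
by case: (level j) => // l; rewrite leq_pmulr.
Qed.

(** If A misses the block [b, b^2), then it has at most b elements below b^2,
    a proportion of at most 1 / b: this falls below any fixed positive bound
    once b is large. *)
Lemma level_blocks_met (R : realType) (A : set nat) :
  0 < lower_density R A ->
  exists N : nat, forall n, (N <= n)%N -> exists2 j, level j = n & A j.
Proof.
move=> /lower_density_gt0[c c_gt0 [N cA]].
have [K cK] : exists K : nat, c^-1 < K%:R.
  by exists (Num.truncn c^-1).+1; exact: truncnS_gt.
exists (N + K)%N.+1 => n Nn; apply/not_exists2P => missA.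
have nb : (n < 2 ^ 2 ^ n)%N.
  by apply: ltn_trans (ltn_expl n (ltnSn 1)) _; exact: ltn_expl.
set b := (2 ^ 2 ^ n)%N in nb *.
have gapA : (count_below A (b * b) <= b)%N.
  apply: count_below_gap => i; rewrite -expnD addnn -mul2n -expnS => /level_eq li.
  by case: (missA i).
have Nbb : (N < b * b)%N by apply: (@leq_trans b); [lia | apply: leq_pmulr; lia].
have : c * (b * b)%:R <= b%:R by rewrite (le_trans (cA _ Nbb)) ?ler_nat.
have b_gt0 : 0 < b%:R :> R by rewrite ltr0n; lia.
rewrite natrM mulrA -[leRHS]mul1r ler_pM2r // -ler_pdivlMl // mulr1.
apply/negP; rewrite -ltNge; apply: lt_le_trans cK _.
by rewrite ler_nat; lia.
Qed.

(** * Tracing a pseudo-orbit that switches between two phases *)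

Section Dynamics.
Context (R : realType) (X : metricType R) (f : X -> X).

Lemma open_iter_preimage (n : nat) (V : set X) :
  continuous f -> open V -> open (iter n f @^-1` V).
Proof.
move=> fc; elim: n V => [//|n IHn] V oV.
have -> : iter n.+1 f @^-1` V = iter n f @^-1` (f @^-1` V) by [].
by apply: IHn; move/continuousP: fc; apply.
Qed.

Lemma iter_surj (n : nat) (y : X) :
  set_surj [set: X] [set: X] f -> exists x, iter n f x = y.
Proof.
move=> fs; elim: n y => [|n IHn] y; first by exists y.
by have [z _ <-] := fs y I; have [x <-] := IHn z; exists x.
Qed.

Lemma hitting_timesP (n : nat) (U V : set X) :
  hitting_times f U V n <->
  (0 < n)%N /\ exists x, U x /\ V (iter n f x).
Proof.
split=> -[n0].
  by move=> [_ [[x Ux <-] Vx]]; split=> //; exists x.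
by move=> [x [Ux Vx]]; split=> //; exists (iter n f x); split=> //; exists x.
Qed.

(** The pseudo-orbit is an exact orbit except where the level changes. *)
Lemma switching_pseudo_orbit (delta : R) (u : X) (r : nat) :
  0 < delta ->
  ergodic_pseudo_orbit f delta (fun j => iter (j + r * odd (level j)) f u).
Proof.
move=> delta_gt0; rewrite /ergodic_pseudo_orbit; set J := [set i | _].
have countJ n : (count_below J n <= level n)%N.
  apply: count_below_jumps level_homo _ => i di; apply/eqP => ei.
  by move: di; rewrite /J /= -ei mdistxx leNgt delta_gt0.
apply/cvgrPdist_lt => e e_gt0; exists (Num.truncn (e ^- 2)).+1 => // n /= en.
rewrite sub0r normrN ger0_norm ?divr_ge0 //.
have n_gt0 : 0 < n%:R :> R by rewrite ltr0n; lia.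
have e2n : 1 < e ^+ 2 * n%:R.
  rewrite -ltr_pdivrMl ?exprn_gt0 // mulr1; apply: lt_le_trans (truncnS_gt _) _.
  by rewrite ler_nat.
(* Compare squares: (level n)^2 <= n < (e n)^2. *)
rewrite ltr_pdivrMr // -(ltr_pXn2r (n := 2)) ?nnegrE ?mulr_ge0 ?(ltW e_gt0) //.
apply: le_lt_trans (_ : n%:R < _).
  rewrite -natrX ler_nat; apply: leq_trans (level_sqr n).
  by rewrite -mulnn leq_mul.
by rewrite exprMn [n%:R ^+ 2]expr2 mulrA -[ltLHS]mul1r ltr_pM2r.
Qed.

(** A Lebesgue number argument: by minimality the preimages of W under the
    iterates of f cover the orbit closure of u, which is compact, so the ball
    of some fixed radius around any point of this closure lies in one of
    them. *)
Lemma minimal_uniform_visit (W : set X) (u : X) :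
  compact [set: X] -> continuous f -> open W -> W u -> minimal_point f u ->
  exists2 eps : R, 0 < eps & forall i a, mdist a (iter i f u) < eps ->
    exists e, W (iter e f (iter i f u)) /\ W (iter e f a).
Proof.
move=> Xc fc oW Wu [_ umin]; pose K := closure (orbit_set f u).
have Ku i : K (iter i f u) by apply: subset_closure; exists i.
have Kc : compact K.
  by apply: subclosed_compact Xc _ => //; exact: closed_closure.
pose P (d : R) y := exists e, W (iter e f y) /\
  forall a, mdist a y < d -> W (iter e f a).
have : \forall d \near 0^'+, K `<=` P d.
  move/compact_near_coveringP : Kc; apply => y Ky.
  have [v [[e _ ev] Wv]] := umin y Ky u (Ku 0%N) W (open_nbhs_nbhs (conj oW Wu)).
  have oV := @open_iter_preimage e _ fc oW.
  have /nbhs_ballP[r /= r_gt0 rV] : nbhs y (iter e f @^-1` W).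
    by apply: open_nbhs_nbhs; split=> //=; rewrite ev.
  exists (ball y (r / 2), [set d | d < r / 2]) => /=.
    by split; [exact/nbhsx_ballx/divr_gt0 | exact/nbhs_right_lt/divr_gt0].
  rewrite ballEmdist => -[y' d] /= [yy' dr]; exists e.
  move: rV; rewrite ballEmdist => rV; split=> [|a ay']; apply: rV => /=.
    lra.
  have := metric_triangle y y' a; rewrite (metric_sym y' a); lra.
move=> nearP; have [d [KP d_gt0]] : exists d, K `<=` P d /\ 0 < d.
  by apply: (filter_ex (F := 0^'+)); apply: filterI nearP _; exact: nbhs_right_gt.
exists d => // i a ia; have [e [We Wa]] := KP _ (Ku i); exists e; split=> //.
exact: Wa.
Qed.

(** The orbit of z supplies the return time t, and the orbit of u supplies
    t + r, the shift being the difference between the two phases followed by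
    the pseudo-orbit. *)
Lemma shifted_return_times (alpha : R) (W : set X) (u : X) (r : nat) :
  0 <= alpha -> compact [set: X] -> continuous f -> density_shadowing f alpha ->
  open W -> W u -> minimal_point f u ->
  exists t x y, [/\ (0 < t)%N, W x /\ W (iter t f x) &
    W y /\ W (iter (t + r) f y)].
Proof.
move=> alpha_ge0 Xc fc shadow oW Wu umin.
have [eps eps_gt0 visit] := minimal_uniform_visit Xc fc oW Wu umin.
have [delta delta_gt0 trace] := shadow _ eps_gt0.
have [z] := trace _ (switching_pseudo_orbit u r delta_gt0).
move=> /(le_lt_trans alpha_ge0) /level_blocks_met[N met].
(* Even levels follow the orbit of u, odd levels run ahead by r; the second
   level is chosen so high that j' exceeds j + e. *)
have [j lj /visit[e [We zWe]]] := met (2 * N)%N ltac:(lia).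
have [j' lj' /visit[e' [We' zWe']]] := met (2 * (N + j + e)).+1 ltac:(lia).
have := level_le j'; move: We We'; rewrite lj lj' /= !mul2n !odd_double /=.
rewrite muln0 addn0 muln1 -!iterD => We We' le_j'.
exists (e' + j' - (e + j))%N, (iter (e + j) f z), (iter (e + j) f u).
rewrite -!iterD in zWe zWe' *; split; first lia.
- by have -> : (e' + j' - (e + j) + (e + j) = e' + j')%N by lia.
- by have -> : (e' + j' - (e + j) + r + (e + j) = e' + (j' + r))%N by lia.
Qed.

(** * From return times to weak mixing *)

(** Exchanges the roles of B and C: it reduces a common time in N(A, B) and
    N(C, D) to a common time n in N(A, C) and N(B, D), which is what makes the
    two sets in the hypothesis nonempty. *)
Lemma hitting_swap (A B C D : set X) (n t : nat) :
  hitting_times f (A `&` iter n f @^-1` C) (B `&` iter n f @^-1` D) t ->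
  hitting_times f A B t /\ hitting_times f C D t.
Proof.
move=> /hitting_timesP[t_gt0 [x [[Ax Cx] [Bx Dx]]]].
split; apply/hitting_timesP; split=> //; first by exists x.
by exists (iter n f x); split=> //; rewrite -iterD addnC iterD.
Qed.

(** Open sets of the product contain open boxes, and on boxes transitivity of
    the product map is the simultaneous hitting of the two factors. *)
Lemma weakly_mixing_hitting :
  (forall A B C D : set X, open A -> open B -> open C -> open D ->
    A !=set0 -> B !=set0 -> C !=set0 -> D !=set0 ->
    hitting_times f A B `&` hitting_times f C D !=set0) ->
  weakly_mixing f.
Proof.
move=> hit P Q oP oQ [p Pp] [q Qq].
have [[A C] /= [Ap Cp] ACP] := open_nbhs_nbhs (conj oP Pp).
have [[B D] /= [Bq Dq] BDQ] := open_nbhs_nbhs (conj oQ Qq).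
have ne (E : set X) (x : X) : nbhs x E -> E^° !=set0 by exists x.
have [n [/hitting_timesP[n_gt0 [a [Aa Ba]]] /hitting_timesP[_ [c [Cc Dc]]]]] :=
  hit _ _ _ _ (open_interior A) (open_interior B) (open_interior C)
    (open_interior D) (ne _ _ Ap) (ne _ _ Bq) (ne _ _ Cp) (ne _ _ Dq).
exists n; split=> //; exists (iter n f a, iter n f c); split.
  exists (a, c); first by apply: ACP; split; exact: interior_subset.
  by elim: (n) => //= k ->.
by apply: BDQ; split; exact: interior_subset.
Qed.

(** Three steps towards a common time in N(A, B) and N(C, D).  For N(A, A)
    and N(B, D) ([loop]), apply the hypothesis to a small W that starts in A,
    passes through B at time p and reaches D at time r + p.  Swapping gives a
    common time in N(A, B) and N(A, D) ([fork]).  In general, apply this to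
    the points of A that reach C at time q, with f^-q(D) in place of D. *)
Lemma M_system_weakly_mixing :
  set_surj [set: X] [set: X] f -> continuous f -> M_system f ->
  (forall W u r, open W -> W u -> minimal_point f u ->
    exists t x y, [/\ (0 < t)%N, W x /\ W (iter t f x) &
      W y /\ W (iter (t + r) f y)]) ->
  weakly_mixing f.
Proof.
move=> fs fc [ft mdense] shifted.
have pre n V : open V -> open (iter n f @^-1` V) by exact: open_iter_preimage.
have pre0 n (V : set X) : V !=set0 -> iter n f @^-1` V !=set0.
  by move=> [v Vv]; have [x xv] := iter_surj n v fs; exists x; rewrite /= xv.
have meet U V : open U -> open V -> U !=set0 -> V !=set0 ->
    exists n, open (U `&` iter n f @^-1` V) /\ U `&` iter n f @^-1` V !=set0.
  move=> oU oV U0 V0; have [n /hitting_timesP[_ nUV]] := ft U V oU oV U0 V0.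
  by exists n; split=> //; apply: openI => //; exact: pre.
have loop A B D : open A -> open B -> open D -> A !=set0 -> B !=set0 ->
    D !=set0 -> hitting_times f A A `&` hitting_times f B D !=set0.
  move=> oA oB oD A0 B0 D0; have [p [oU U0]] := meet _ _ oA oB A0 B0.
  have [r [oW W0]] := meet _ _ oU (pre p _ oD) U0 (pre0 p _ D0).
  have [u [Wu umin]] := mdense _ W0 oW.
  have [t [x [y [t_gt0 [Wx Wtx] [Wy Wty]]]]] := shifted _ u r oW Wu umin.
  exists (t + r)%N; split; apply/hitting_timesP; split; try lia.
    by exists y; split; [exact: Wy.1.1 | exact: Wty.1.1].
  exists (iter p f x); split; first exact: Wx.1.2.
  have := Wtx.2; rewrite /= -!iterD.
  by have -> : (p + r + t = t + r + p)%N by lia.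
have fork A B D : open A -> open B -> open D -> A !=set0 -> B !=set0 ->
    D !=set0 -> hitting_times f A B `&` hitting_times f A D !=set0.
  move=> oA oB oD A0 B0 D0.
  have [n [/hitting_timesP[_ nAA] /hitting_timesP[_ nBD]]] :=
    loop _ _ _ oA oB oD A0 B0 D0.
  have [||t /hitting_swap tAB] := ft _ _ _ _ nAA nBD; last by exists t.
  - by apply: openI => //; exact: pre.
  - by apply: openI => //; exact: pre.
apply: weakly_mixing_hitting => A B C D oA oB oC oD A0 B0 C0 D0.
have [q [oU U0]] := meet _ _ oA oC A0 C0.
have [n [/hitting_timesP[n_gt0 [x [[Ax _] Bx]]]]] :=
  fork _ _ _ oU oB (pre q _ oD) U0 B0 (pre0 q _ D0).
move=> /hitting_timesP[_ [y [[_ Cy] Dy]]].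
exists n; split; apply/hitting_timesP; split=> //; first by exists x.
by exists (iter q f y); split=> //; rewrite -iterD addnC iterD.
Qed.

End Dynamics.

Theorem theorem3p1 (R : realType) (alpha : R) (X : metricType R) (f : X -> X) :
  0 <= alpha < 1 ->
  dynamical_system f ->
  M_system f ->
  density_shadowing f alpha ->
  weakly_mixing f.
Proof.
move=> /andP[alpha_ge0 _] [Xc fc fs] Mf shadow.
apply: M_system_weakly_mixing => // W u r oW Wu umin.
exact: shifted_return_times alpha_ge0 Xc fc shadow oW Wu umin.
Qed.
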